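(* Fix $\epsilon\in(0,1)$ and $\alpha,\beta>0$ with $\alpha+\beta\le\epsilon/4$. Let $M$ be an ordered matching on $2n^{1/2+\alpha}$ vertices with interval chromatic number $2$, such that its corresponding permutation $\pi=\pi(M)$ satisfies $\mathrm{Int}(\pi,\pi+h)\le n^{(1-\epsilon)(1/2+\alpha)}$ for every $h\in[n^{1/2+\alpha}]$. Then every red/blue coloring of the edges of the ordered complete graph on $[2n]$ contains either (i) a blue triangle, (ii) a red clique on at least $n^{1/2+\beta}/4-n^{\epsilon/4}/2$ vertices, or (iii) a red ordered copy of $M$ within the bipartite subgraph between $[1,n]$ and $[n+1,2n]$ (i.e., the first half of the vertices of $M$ are mapped into $[1,n]$ and the second half into $[n+1,2n]$).
   Context: An ordered graph on $[N]$ is a graph with vertex set $\{1,\dots,N\}$ with the natural order; a red ordered copy of an ordered graph $G$ on $[p]$ in a red/blue coloring of the complete graph on $[N]$ is a strictly increasing map $\varphi:[p]\to[N]$ with $\varphi(u)\varphi(v)$ red for every edge $uv$ of $G$. The interval chromatic number of an ordered graph is the minimum number of contiguous intervals into which the vertex set can be split so that each interval is independent. An ordered matching $M$ on $[2m]$ with interval chromatic number $2$ has every edge between $[1,m]$ and $[m+1,2m]$; its corresponding permutation $\pi(M)\in S_m$ maps $i$ to $j-m$ for every edge $\{i,j\}$ of $M$ with $i\le m<j$. For a sequence $\sigma=(\sigma(1),\dots,\sigma(m))$ of distinct integers, an exact pattern of $\sigma$ is a sequence $\rho=(\rho(1),\dots,\rho(k))$ such that there are indices $1\le i_1<\dots<i_k\le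 m$ with $\sigma(i_j)=\rho(j)$ for all $j$. For $\pi\in S_m$ and an integer $h$, $\pi+h$ denotes the sequence $(\pi(1)+h,\dots,\pi(m)+h)$. The ordered intersection $\mathrm{Int}(\sigma,\tau)$ of two such sequences is the largest $k$ such that $\sigma$ and $\tau$ share a common exact pattern of length $k$. *)

(* Defs.v *)
From mathcomp Require Import all_boot.
From mathcomp Require Import perm ssralg ssrint.
From Stdlib Require Import Reals.

Set Implicit Arguments.
Unset Strict Implicit.
Unset Printing Implicit Defensive.

(* A red/blue colouring of the edges of the complete graph on [N] (vertices
   0..N-1 standing for 1..N).  [col u v] for u < v is the colour of the edge
   {u,v}: true = red, false = blue; col on other pairs is ignored. *)
Definition red (N : nat) (col : 'I_N -> 'I_N -> bool) (u v : 'I_N) : bool :=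
  if (u < v)%N then col u v else col v u.

Definition blue_triangle (N : nat) (col : 'I_N -> 'I_N -> bool) : Prop :=
  exists u v w : 'I_N, [/\ u != v, v != w & u != w] /\
    [/\ ~~ red col u v, ~~ red col v w & ~~ red col u w].

Definition red_clique (N : nat) (col : 'I_N -> 'I_N -> bool) (S : {set 'I_N}) : Prop :=
  forall u v, u \in S -> v \in S -> u != v -> red col u v.

(* The ordered matching M on [2m] with interval chromatic number 2 whose
   permutation is pi: edges {i, m + pi(i)} (0-based). *)
Definition matching_edge (m : nat) (pi : {perm 'I_m}) (i j : 'I_(2 * m)) : Prop :=
  exists k : 'I_m, (i : nat) = k /\ (j : nat) = (m + pi k)%N.

Definition red_bip_copy (n m : nat) (pi : {perm 'I_m})
    (col : 'I_(2 * n) -> 'I_(2 * n) -> bool) : Prop :=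
  exists phi : 'I_(2 * m) -> 'I_(2 * n),
    [/\ (forall i j : 'I_(2 * m), (i < j)%N -> (phi i < phi j)%N),
        (forall i : 'I_(2 * m), (i < m)%N -> (phi i < n)%N),
        (forall i : 'I_(2 * m), (m <= i)%N -> (n <= phi i)%N)
      & (forall i j, matching_edge pi i j -> red col (phi i) (phi j))].

Definition perm_seq (m : nat) (pi : {perm 'I_m}) : seq int :=
  [seq Posz (pi i).+1 | i : 'I_m <- enum 'I_m].

Definition shift_seq (s : seq int) (h : int) : seq int := [seq GRing.add x h | x <- s].

(* Ordered intersection: largest length of a common exact pattern.  An exact
   pattern of sigma is mask b sigma for a bitmask b (increasing indices);
   mathcomp's [subseq rho tau] says rho is an exact pattern of tau. *)
Definition Int (sigma tau : seq int) : nat :=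
  \max_(b : (size sigma).-tuple bool | subseq (mask b sigma) tau) size (mask b sigma).

(* Main.v *)
(* Blue neighbourhoods are red cliques, so blue degrees are below the bound of (ii). Send the
   right half of [M] onto the window [n + t, n + t + m) of consecutive vertices and match its
   left half greedily inside [0, n). If this fails, at least [n - m] vertices stall, each one
   giving a blue edge to the window. Two windows at distance [h] share at most
   [Int (pi, pi + h)] right endpoints of such edges, hence few edges. By Bonferroni, the first
   floor(n^(eps/4)) windows together yield more blue edges than the degree bound allows. *)
Require Import Defs.
From mathcomp Require Import all_boot perm ssralg ssrint zify.
From Stdlib Require Import Reals Lra Classical.

Set Implicit Arguments.
Unset Strict Implicit.
Unset Printing Implicit Defensive.

(** * Greedy embedding of one half of the matching *)

Section Greedy.

Variables (m : nat) (ok : nat -> nat -> bool).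

(** The counter after the host vertices below [u] have been scanned: how many vertices of the left
    half are placed, hence also the index of the next one to place. [ok v i] says that [v] may host
    [i]. *)
Fixpoint greedy (u : nat) : nat :=
  if u is v.+1 then
    if (greedy v < m) && ok v (greedy v) then (greedy v).+1 else greedy v
  else 0.

Arguments greedy : simpl never.

Lemma greedyS u :
  greedy u.+1 = if (greedy u < m) && ok u (greedy u) then (greedy u).+1 else greedy u.
Proof. by []. Qed.

Lemma leq_greedyS u : greedy u <= greedy u.+1.
Proof. by rewrite greedyS; case: ifP. Qed.

Lemma leq_greedy : {homo greedy : u v / u <= v}.
Proof. exact: homo_leq leqnn leq_trans leq_greedyS. Qed.

Lemma greedy_max u : greedy u <= m.
Proof. by elim: u => // u IHu; rewrite greedyS; case: ifP => // /andP[]. Qed.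

(** The counter rises by at most one per step, so it cannot skip the value [i]; the step that leaves
    [i] passed the test. *)
Lemma greedy_hit n i : i < greedy n ->
  exists u : 'I_n, greedy u = i /\ ok u i.
Proof.
elim: n => // n IHn; rewrite greedyS.
have [/IHn [u [gu oku]] _ | le_gi] := ltnP i (greedy n).
  by exists (widen_ord (leqnSn n) u).
case: ifP => [/andP[_ okn] | _]; last by rewrite ltnNge le_gi.
rewrite ltnS => le_ig; exists ord_max => /=.
by have -> : i = greedy n by apply/eqP; rewrite eqn_leq le_ig.
Qed.

Definition stalls n := [set u : 'I_n | greedy u.+1 == greedy u].

Lemma card_stalls n : n = #|stalls n| + greedy n.
Proof.
rewrite -sum1dep_card big_mkcond.
elim: n => [|n IHn]; first by rewrite big_ord0.
apply: etrans (congr1 succn IHn) _.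
rewrite big_ord_recr -addnA -addnS /=; congr (_ + _).
by rewrite greedyS; case: (_ && _); [rewrite gtn_eqF | rewrite eqxx].
Qed.

Lemma greedy_embedding n : greedy n = m ->
  exists p : 'I_m -> 'I_n,
    (forall i j : 'I_m, i < j -> p i < p j) /\ (forall i, ok (p i) i).
Proof.
move=> gn.
(* [i] is placed where the counter moves from [i] to [i.+1]; monotonicity of the counter then makes
   the placement increasing. *)
have hit (i : 'I_m) : exists u : 'I_n, greedy u = i /\ ok u i.
  by apply: greedy_hit; rewrite gn.
have [p pP] := fin_all_exists hit; exists p; split=> [i j lt_ij | i]; last first.
  by have [] := pP i.
rewrite ltnNge; apply/negP => /leq_greedy.
by have [-> _] := pP i; have [-> _] := pP j; rewrite leqNgt lt_ij.
Qed.

(** A stall has two possible causes, a full counter or a failed test; the first is excluded when the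
    counter ends below [m]. *)
Lemma stallsP n (u : 'I_n) : greedy n < m -> u \in stalls n -> ~~ ok u (greedy u).
Proof.
move=> gn; rewrite inE greedyS.
have -> : greedy u < m by apply: leq_ltn_trans gn; apply/leq_greedy/ltnW.
by case: ok => //=; rewrite gtn_eqF.
Qed.

End Greedy.

(** * Counting tools and exact patterns *)

Lemma card_leq_imset_mul (aT rT : finType) (h : aT -> rT) (X : {set aT}) d :
  (forall c, #|[set x in X | h x == c]| <= d) -> #|X| <= #|h @: X| * d.
Proof.
move=> fib; rewrite -sum1_card (partition_big_imset h) /= -sum_nat_const.
apply: leq_sum => c _; apply: leq_trans (fib c).
by rewrite -sum1_card; apply: eq_leq; apply: eq_bigl => x; rewrite inE.
Qed.

Lemma leq_bonferroni (T : finType) (E : nat -> {set T}) W :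
  \sum_(t < W) #|E t| <=
    #|\bigcup_(t < W) E t| + \sum_(t < W) \sum_(s < t) #|E s :&: E t|.
Proof.
elim: W => [|W IHW]; first by rewrite !big_ord0.
rewrite !big_ord_recr /= cardsU.
set U := \bigcup_(t < W) E t in IHW *.
have le_cap : #|U :&: E W| <= \sum_(s < W) #|E s :&: E W|.
  rewrite big_distrl /=.
  elim/big_rec2: _ => [|i a b _ le_ba]; first by rewrite cards0.
  apply: leq_trans (leq_add (leqnn _) le_ba).
  by rewrite cardsU leq_subr.
apply: leq_trans (leq_add IHW (leqnn _)) _.
move: le_cap; set c := #|U :&: E W|; set e := #|E W|.
set S1 := \sum_(t < W) _; set S2 := \sum_(t < W) _; lia.
Qed.

Lemma subseq_map_nth (T : eqType) (x0 : T) (s : seq T) (idx : seq nat) :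
  sorted ltn idx -> all (gtn (size s)) idx -> subseq (map (nth x0 s) idx) s.
Proof.
move=> idx_sorted /allP idx_lt.
rewrite -[X in subseq _ X](mkseq_nth x0) /mkseq; apply: map_subseq.
(* A strictly increasing list is determined by its members, so [idx] is a filtered [iota]. *)
suff -> : idx = [seq i <- iota 0 (size s) | i \in idx] by apply: filter_subseq.
apply: (irr_sorted_eq ltn_trans ltnn) => //.
  by apply: sorted_filter (iota_ltn_sorted _ _); apply: ltn_trans.
move=> i; rewrite mem_filter mem_iota add0n /=.
by case: (boolP (i \in idx)) => // /idx_lt /= ->.
Qed.

Lemma leq_Int (rho sigma tau : seq int) :
  subseq rho sigma -> subseq rho tau -> size rho <= Int sigma tau.
Proof.
case/subseqP => b size_b -> sub_tau; rewrite /Int.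
have b_size : size b == size sigma by rewrite size_b.
exact: (leq_bigmax_cond (Tuple b_size)).
Qed.

Definition int_seq (s : seq nat) : seq int := [seq Posz x.+1 | x <- s].

(** * Missing edges of sliding windows *)

Section Windows.

Variables (n : nat) (s : seq nat) (R : nat -> nat -> bool).
Let m := size s.
Hypotheses (s_uniq : uniq s) (s_lt : all (gtn m) s).

(** Right vertices are numbered from the start of the right half. The partner of [i] sits at offset
    [nth 0 s i] in the window starting at [t], and [R] stands for a red edge. *)
Definition window_greedy t := greedy m (fun u i => R u (t + nth 0 s i)).
Local Notation g := window_greedy.

(* The edges missing from [R] that stall the greedy embedding at window [t]; the right
   endpoints are bounded by [M] only to stay in a finite type. *)
Definition window_edges M t : {set 'I_n * 'I_M} :=
  [set x : 'I_n * 'I_M | (x.1 \in stalls m (fun u i => R u (t + nth 0 s i)) n)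
           && (x.2 == t + nth 0 s (g t x.1) :> nat)].
Local Notation E := window_edges.

Lemma window_edge_missing M t (x : 'I_n * 'I_M) :
  g t n < m -> x \in E M t -> ~~ R x.1 x.2.
Proof. by move=> gm; rewrite inE => /andP[+ /eqP ->]; apply: stallsP. Qed.

Lemma leq_card_window M t : g t n < m -> t + m <= M -> n - m <= #|E M t|.
Proof.
move=> gm tM.
have le_st : n - m <= #|stalls m (fun u i => R u (t + nth 0 s i)) n|.
  rewrite leq_subLR [leqLHS](card_stalls m (fun u i => R u (t + nth 0 s i)) n) addnC.
  by rewrite leq_add2r greedy_max.
apply: leq_trans le_st (leq_trans _ (leq_imset_card fst (E M t))).
apply: subset_leq_card; apply/subsetP => u u_st.
have gu : g t u < m by apply: leq_ltn_trans gm; apply/leq_greedy/ltnW.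
have cM : t + nth 0 s (g t u) < M.
  apply: leq_trans tM; rewrite -addnS leq_add2l.
  by apply: (allP s_lt); apply: mem_nth.
by apply/imsetP; exists (u, Ordinal cM); rewrite // inE u_st /=.
Qed.

(* Listed in the order of their left endpoints, the shared right endpoints form a
   common exact pattern of [pi] and [pi + h]. *)
Lemma leq_shared_Int M t h : g t n < m -> g (t + h) n < m ->
  #|snd @: (E M t :&: E M (t + h))| <= Int (int_seq s) (shift_seq (int_seq s) (Posz h)).
Proof.
move=> gm gm'; set X := E M t :&: E M (t + h); set C := snd @: X.
(* [nu c] is a left endpoint joined to [c] in both windows. *)
have rep (c : 'I_M) : exists u : nat, c \in C ->
    [/\ u < n, c = t + nth 0 s (g t u) :> nat
      & c = t + h + nth 0 s (g (t + h) u) :> nat].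
  case: (boolP (c \in C)) => [/imsetP[[u d] /setIP[] + + ->] /= | _]; last by exists 0.
  by rewrite !inE /= => /andP[_ /eqP e1] /andP[_ /eqP e2]; exists u; split.
have [nu nuP] := fin_all_exists rep.
pose us := sort leq [seq nu c | c <- enum C].
have usP u : u \in us -> exists2 c, c \in C & u = nu c.
  by rewrite mem_sort => /mapP[c]; rewrite mem_enum; exists c.
have pattern t' : g t' n < m ->
    (forall c, c \in C -> c = t' + nth 0 s (g t' (nu c)) :> nat) ->
    subseq [seq nth 0 s (g t' u) | u <- us] s.
  move=> gm1 valc; rewrite (map_comp (nth 0 s)); apply: subseq_map_nth; last first.
    apply/allP => _ /mapP[u /usP[c cC ->] ->] /=.
    by have [un _ _] := nuP c cC; apply: leq_ltn_trans gm1; apply/leq_greedy/ltnW.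
  (* Along [us] the counter is weakly increasing. It never repeats a value, since equal counters
     would give the same right endpoint [c]. *)
  rewrite ltn_sorted_uniq_leq; apply/andP; split; last first.
    apply: homo_sorted (sort_sorted leq_total _); exact: leq_greedy.
  apply: (@map_uniq _ _ (fun i => t' + nth 0 s i)); rewrite -map_comp.
  rewrite (perm_uniq (perm_map _ (permEl (perm_sort _ _)))) -map_comp.
  rewrite (_ : map _ _ = [seq nat_of_ord c | c <- enum C]) ?(map_inj_uniq (@ord_inj _)) ?enum_uniq //.
  by apply/eq_in_map => c; rewrite mem_enum /= => /valc ->.
have pat1 := pattern t gm (fun c cC => let: And3 _ e _ := nuP c cC in e).
have pat2 := pattern (t + h) gm' (fun c cC => let: And3 _ _ e := nuP c cC in e).
have -> : #|C| = size (int_seq [seq nth 0 s (g t u) | u <- us]).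
  by rewrite !size_map size_sort size_map cardE.
apply: leq_Int; first exact: map_subseq.
(* Each [c] has offset [c - t] in one window and [c - t - h] in the other, so the two patterns
   differ by [h] entrywise. *)
rewrite (_ : int_seq _ = shift_seq (int_seq [seq nth 0 s (g (t + h) u) | u <- us]) (Posz h)).
  by do 2!apply: map_subseq.
rewrite /shift_seq /int_seq -!map_comp; apply/eq_in_map => u /usP[c cC ->] /=.
have [_ e1 e2] := nuP c cC; congr Posz.
lia.
Qed.

(** Bonferroni over the windows starting at 0, ..., [W - 1]. Together they cover [m + W - 1] right
    vertices, each in at most [d] missing edges; two of them share at most [k] right endpoints,
    hence [k * d] edges. *)
Lemma window_count W d k : 0 < m ->
  (forall t, t < W -> g t n < m) ->
  (forall c, c < (m + W).-1 -> #|[set u : 'I_n | ~~ R u c]| <= d) ->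
  (forall h, 0 < h < W -> Int (int_seq s) (shift_seq (int_seq s) (Posz h)) <= k) ->
  W * (n - m) <= (m + W).-1 * d + 'C(W, 2) * (k * d).
Proof.
move=> m_gt0 gm degR Intk; set M := (m + W).-1.
have fibre (X : {set 'I_n * 'I_M}) : (forall x, x \in X -> ~~ R x.1 x.2) ->
    #|X| <= #|snd @: X| * d.
  move=> missX; apply: card_leq_imset_mul => c; apply: leq_trans (degR c (ltn_ord c)).
  rewrite -(card_in_imset (f := fst)).
    apply/subset_leq_card/subsetP => _ /imsetP[x + ->]; rewrite !inE => /andP[xX /eqP <-].
    exact: missX.
  move=> [u c1] [v c2]; rewrite !inE /= => /andP[_ /eqP ->] /andP[_ /eqP ->] -> //.
have -> : W * (n - m) = \sum_(t < W) (n - m) by rewrite sum_nat_const card_ord.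
apply: (@leq_trans (\sum_(t < W) #|E M t|)).
  apply: leq_sum => t _; apply: leq_card_window; first exact: gm.
  by rewrite /M; move: (ltn_ord t) m_gt0; lia.
apply: leq_trans (leq_bonferroni _ _) _; apply: leq_add.
  apply: leq_trans (fibre _ _) _ => //.
    by move=> x /bigcupP[t _]; apply: window_edge_missing; apply: gm.
  by rewrite leq_mul2r -[X in _ <= X]card_ord max_card orbT.
rewrite -bin2_sum big_mkord big_distrl /=; apply: leq_sum => t _.
rewrite -[X in X * (k * d)]card_ord -sum_nat_const; apply: leq_sum => r _.
have r_lt := ltn_trans (ltn_ord r) (ltn_ord t).
apply: leq_trans (fibre _ _) _ => //.
  by move=> x /setIP[+ _]; apply: window_edge_missing; apply: gm.
rewrite leq_mul2r; apply/orP; right.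
have := @leq_shared_Int M r (t - r) (gm r r_lt).
rewrite (subnKC (ltnW (ltn_ord r))) => /(_ (gm t (ltn_ord t))) le_Int.
apply: leq_trans le_Int _.
by apply: Intk; rewrite subn_gt0 ltn_ord (leq_ltn_trans (leq_subr _ _)).
Qed.

End Windows.

(** * Transfer to colourings of the complete graph *)

Lemma red_sym N (col : 'I_N -> 'I_N -> bool) u v : red col u v = red col v u.
Proof. by rewrite /red; case: ltngtP => // /ord_inj ->. Qed.

Definition blue_nbhd N (col : 'I_N -> 'I_N -> bool) v :=
  [set u | (u != v) && ~~ red col v u].

Lemma blue_nbhd_red_clique N (col : 'I_N -> 'I_N -> bool) v :
  ~ blue_triangle col -> red_clique col (blue_nbhd col v).
Proof.
move=> no_tri u w; rewrite !inE => /andP[uv bu] /andP[wv bw] uw.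
apply/idPn => buw; apply: no_tri; exists v, u, w.
by split; split; rewrite // eq_sym.
Qed.

Lemma perm_seq_int_seq m (pi : {perm 'I_m}) :
  perm_seq pi = int_seq [seq val (pi i) | i <- enum 'I_m].
Proof. by rewrite /int_seq -map_comp. Qed.

Section Colouring.

Variables (n m : nat) (pi : {perm 'I_m}) (col : 'I_(2 * n) -> 'I_(2 * n) -> bool).

Lemma red_bip_copyP (n_gt0 : 0 < n) t (p : 'I_m -> 'I_n) : t + m <= n ->
  (forall i j : 'I_m, i < j -> p i < p j) ->
  (forall (i : 'I_m) (u v : 'I_(2 * n)), u = p i :> nat -> v = n + (t + pi i) :> nat ->
     red col u v) ->
  red_bip_copy pi col.
Proof.
move=> tm p_mono p_red.
have v0 : 'I_(2 * n) by exists 0; rewrite muln_gt0.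
(* The left half follows [p] and the right half is translated onto the window. The default [v0] is
   never taken, because [t + m <= n] keeps every value below [2 * n]. *)
pose phi (i : 'I_(2 * m)) : 'I_(2 * n) :=
  insubd v0 (if insub (val i) is Some j then val (p j) else n + (t + (i - m))).
have phi_lt (i : 'I_(2 * m)) (im : i < m) : phi i = p (Ordinal im) :> nat.
  rewrite /phi insubT /= insubdK // -topredE /=.
  by apply: leq_trans (ltn_ord _) _; rewrite mul2n -addnn leq_addr.
have phi_ge (i : 'I_(2 * m)) : m <= i -> phi i = n + (t + (i - m)) :> nat.
  move=> mi; rewrite /phi insubN -?leqNgt //= insubdK // -topredE /=.
  by move: (ltn_ord i) tm mi; lia.
exists phi; split.
- move=> i j lt_ij; have [jm | mj] := ltnP j m.
    by rewrite (phi_lt _ jm) (phi_lt _ (ltn_trans lt_ij jm)) p_mono.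
  rewrite (phi_ge _ mj); have [im | mi] := ltnP i m.
    by rewrite (phi_lt _ im); apply: leq_trans (ltn_ord _) (leq_addr _ _).
  by rewrite phi_ge // !ltn_add2l; lia.
- by move=> i im; rewrite (phi_lt _ im).
- by move=> i mi; rewrite phi_ge ?leq_addr.
move=> i j [k [ik jk]]; apply: (p_red k).
  have im : i < m by rewrite ik.
  by rewrite (phi_lt _ im); congr (nat_of_ord (p _)); apply: val_inj.
by rewrite phi_ge jk ?leq_addr // addKn.
Qed.

Lemma colouring_count W d k : 0 < n -> 0 < m -> (m + W).-1 <= n ->
  ~ red_bip_copy pi col ->
  (forall v, #|blue_nbhd col v| <= d) ->
  (forall h, 0 < h < W -> Int (perm_seq pi) (shift_seq (perm_seq pi) (Posz h)) <= k) ->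
  W * (n - m) <= (m + W).-1 * d + 'C(W, 2) * (k * d).
Proof.
move=> n_gt0 m_gt0 mW no_copy deg_d; rewrite perm_seq_int_seq.
set s := map _ _ => Intk.
have v0 : 'I_(2 * n) by exists 0; rewrite muln_gt0.
pose R u c := red col (insubd v0 u) (insubd v0 (n + c)).
have size_s : size s = m by rewrite size_map size_enum_ord.
have s_uniq : uniq s.
  by rewrite (map_inj_uniq (inj_comp val_inj perm_inj)) enum_uniq.
have s_lt : all (gtn (size s)) s.
  by rewrite size_s; apply/allP => _ /mapP[i _ ->]; apply: ltn_ord.
have nth_s (i : 'I_m) : nth 0 s i = pi i.
  by rewrite (nth_map i) ?size_enum_ord // nth_ord_enum.
rewrite -{1 2}size_s.
apply: (window_count s_uniq s_lt (R := R)) => //; rewrite size_s //.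
  move=> t tW; have tm : t + m <= n by move: mW tW; lia.
  (* A counter that reaches [m] would produce a red copy of the matching. *)
  rewrite /window_greedy size_s ltn_neqAle greedy_max andbT; apply/eqP => /greedy_embedding[p [p_mono p_R]].
  apply: no_copy; apply: (red_bip_copyP n_gt0 tm p_mono) => i u v up vp.
  have := p_R i; rewrite /R nth_s -up -vp.
  by rewrite !valKd.
move=> c cM; apply: leq_trans (deg_d (insubd v0 (n + c))).
have vtxE k1 : k1 < 2 * n -> insubd v0 k1 = k1 :> nat.
  by move=> lt_k1; rewrite insubdK // -topredE.
have lt_vtx (u : 'I_n) : u < 2 * n by rewrite (leq_trans (ltn_ord u)) ?leq_pmull.
have vtx_inj : injective (fun u : 'I_n => insubd v0 (val u)).
  by move=> u1 u2 /(congr1 val); rewrite /= !vtxE // => /ord_inj.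
(* Left endpoints of edges missing at [c] are blue neighbours of the vertex [n + c], which is a
   genuine vertex since [c < n]. *)
rewrite -(card_imset _ vtx_inj); apply/subset_leq_card/subsetP => _ /imsetP[u + ->].
rewrite !inE red_sym /R => ->; rewrite andbT -val_eqE /= !vtxE //; last by lia.
by rewrite ltn_eqF // (leq_trans (ltn_ord u)) ?leq_addr.
Qed.

End Colouring.

(** * Real inequalities behind the contradiction *)

(* To be read with s = n^(1/2), A = n^alpha, B = n^beta, X = n^(eps/4), W the floor of X. *)
Lemma window_count_too_small (s A B X W K d : R) :
  (1 <= A -> 1 <= B -> A * B <= X -> X * X <= s ->
   W = 1 \/ 2 <= W -> W <= X < W + 1 -> 0 <= d <= (s * B - 2 * X) / 4 ->
   0 <= K -> K * (s * B) * X <= s * s ->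
   (s * A + W - 1) * d + W * (W - 1) / 2 * (K * d) < W * (s * s - s * A))%R.
Proof.
move=> A1 B1 AB XX W12 [WX XW] [d0 dD] K0 KX.
have [AX BX] : (A <= X /\ B <= X)%R by nra.
have [sX s1] : (X <= s /\ 1 <= s)%R by nra.
have W1 : (1 <= W)%R by lra.
have bound_pairs : (W * (W - 1) / 2 * (K * d) <= (W - 1) * (s * s) / 8)%R.
  have dle : (d <= s * B / 4)%R by lra.
  have Kd : (K * d * X <= s * s / 4)%R by nra.
  have KdW : (K * d * W <= s * s / 4)%R.
    by apply: Rle_trans Kd; apply: Rmult_le_compat_l WX; apply: Rmult_le_pos.
  by nra.
have bound_union : ((s * A + W - 1) * d
    <= s * (s * X / 4 - A * X / 2 + (W - 1) * B / 4))%R.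
  have sA0 : (0 <= s * A)%R by nra.
  apply: (Rle_trans _ ((s * A + W - 1) * ((s * B - 2 * X) / 4))).
    by apply: Rmult_le_compat_l => //; lra.
  (* Expanding the product, [A * B <= X] bounds the leading term and the negative term
     [- (W - 1) * X / 2] is dropped. *)
  have : (s * s * (A * B) <= s * s * X)%R by apply: Rmult_le_compat_l => //; nra.
  have : (0 <= (W - 1) * X)%R by nra.
  by lra.
(* Both bounds and the target carry a factor [s], cancelled here. *)
suff : (s * X / 4 - A * X / 2 + (W - 1) * B / 4 + (W - 1) * s / 8 < W * s - W * A)%R.
  by move=> key; nra.
case: W12 => [W_eq1 | W2]; first by subst W; nra.
(* From [2 <= W <= X] follows [2 * X <= X * X <= s]. The left side is then below [W * s / 2], and
   the right side is at least that. *)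
have [sA sB] : (2 * A <= s /\ 2 * B <= s)%R by nra.
by nra.
Qed.

(** With [s * A = m] and [s * s = n], this places all the windows inside the right half. *)
Lemma windows_fit (s A X W : R) :
  (1 <= A <= X -> X * X <= s -> W = 1 \/ 2 <= W -> W <= X ->
   s * A + W - 1 <= s * s)%R.
Proof.
move=> [A1 AX] XX W12 WX.
have sX : (X <= s)%R by nra.
case: W12 => [-> | W2]; first by nra.
have sX2 : (2 * X <= s)%R by nra.
by nra.
Qed.

Lemma exists_nat_floor (x : R) : (0 <= x)%R -> exists W : nat, (INR W <= x < INR W + 1)%R.
Proof.
move=> x0; have [le_x gt_x] := base_Int_part x.
have ge0 : (0 <= Int_part x)%Z.
  suff : (-1 < Int_part x)%Z by lia.
  by apply: lt_IZR; lra.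
exists (Z.to_nat (Int_part x)).
by rewrite INR_IZR_INZ Znat.Z2Nat.id //; lra.
Qed.

Lemma INR_bin2 W : INR 'C(W, 2) = (INR W * (INR W - 1) / 2)%R.
Proof.
suff : (INR 'C(W, 2) * 2 = INR W * (INR W - 1))%R by lra.
case: W => [|W]; first by rewrite /= !Rmult_0_l.
have -> : (INR W.+1 - 1 = INR W)%R by rewrite S_INR; lra.
by rewrite -[2%R]/(INR 2) -!mult_INR multE (bin_ffact W.+1 2) !ffactnS ffactn0 muln1.
Qed.

Lemma INR_leq a b : a <= b -> (INR a <= INR b)%R.
Proof. by move/leP; apply: le_INR. Qed.

Theorem theorem3p4 (eps alpha beta : R)
  (Heps0 : (0 < eps)%R) (Heps1 : (eps < 1)%R)
  (Halpha : (0 < alpha)%R) (Hbeta : (0 < beta)%R)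
  (Hab : (alpha + beta <= eps / 4)%R)
  (n m : nat) (Hn : (0 < n)%N)
  (Hm : INR m = Rpower (INR n) (1/2 + alpha))
  (pi : {perm 'I_m})
  (Hint : forall h : nat, (1 <= h <= m)%N ->
     (INR (Int (perm_seq pi) (shift_seq (perm_seq pi) (Posz h)))
        <= Rpower (INR n) ((1 - eps) * (1/2 + alpha)))%R)
  (col : 'I_(2 * n) -> 'I_(2 * n) -> bool) :
  blue_triangle col \/
  (exists S : {set 'I_(2 * n)}, red_clique col S /\
     (INR #|S| >= Rpower (INR n) (1/2 + beta) / 4 - Rpower (INR n) (eps / 4) / 2)%R) \/
  red_bip_copy pi col.
Proof.
have [tri | no_tri] := classic (blue_triangle col); [by left | right].
set D := (_ / 4 - _)%R.
have [cl | no_cl] := classic (exists S, red_clique col S /\ (INR #|S| >= D)%R); [by left | right].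
apply: NNPP => no_copy.
have clique_lt S : red_clique col S -> (INR #|S| < D)%R.
  by move=> S_clique; apply: Rnot_ge_lt => S_ge; apply: no_cl; exists S.
(* The empty set is a red clique, so failure of (ii) makes the threshold positive. *)
have D_gt0 : (0 < D)%R.
  by have := clique_lt set0; rewrite cards0; apply=> u v; rewrite inE.
have max_INR a b c : (INR a <= c -> INR b <= c -> INR (maxn a b) <= c)%R.
  by rewrite /maxn; case: ifP.
have n1 : (1 <= INR n)%R by apply: (INR_leq Hn).
set K := Rpower (INR n) ((1 - eps) * (1 / 2 + alpha)) in Hint.
have pow_le a b : (a <= b -> Rpower (INR n) a <= Rpower (INR n) b)%R.
  by apply: Rle_Rpower.
have pow0 a : (0 < Rpower (INR n) a)%R by apply: exp_pos.
have n0 : (0 < INR n)%R by lra.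
pose s := Rpower (INR n) (1 / 2); pose A := Rpower (INR n) alpha.
pose B := Rpower (INR n) beta; pose X := Rpower (INR n) (eps / 4).
have ss : (s * s = INR n)%R.
  by rewrite /s -Rpower_plus -[RHS](Rpower_1 (INR n)) //; congr Rpower; lra.
have A1 : (1 <= A)%R by rewrite -(Rpower_O (INR n)) //; apply: pow_le; lra.
have B1 : (1 <= B)%R by rewrite -(Rpower_O (INR n)) //; apply: pow_le; lra.
have AB : (A * B <= X)%R by rewrite /A /B -Rpower_plus; apply: pow_le.
have XX : (X * X <= s)%R by rewrite /X -Rpower_plus; apply: pow_le; lra.
have mE : INR m = (s * A)%R by rewrite Hm Rpower_plus.
have DE : D = ((s * B - 2 * X) / 4)%R by rewrite /D Rpower_plus -/s -/B -/X; lra.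
(* Since [alpha + beta <= eps / 4], the exponents on the left add up to at most
   [1 - eps * alpha]. *)
have KX : (K * (s * B) * X <= s * s)%R.
  rewrite ss -[X in (_ <= X)%R](Rpower_1 (INR n)) // /K /s /B /X -!Rpower_plus.
  by apply: pow_le; nra.
have [AX BX] : (A <= X /\ B <= X)%R by nra.
have [W [WX XW]] := exists_nat_floor (Rlt_le _ _ (pow0 (eps / 4)%R)).
rewrite -/X in WX XW.
have W12 : INR W = 1%R \/ (2 <= INR W)%R.
  case: W WX XW => [|[|W]] _ /= XW; first by lra.
    by left.
  by right; rewrite -/(INR W.+2) !S_INR; have := pos_INR W; lra.
have fit := windows_fit (conj A1 AX) XX W12 WX.
pose d := \max_(v : 'I_(2 * n)) #|blue_nbhd col v|.
pose k := \max_(h < W | 0 < h) Int (perm_seq pi) (shift_seq (perm_seq pi) (Posz h)).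
have dD : (INR d <= D)%R.
  apply: (big_ind (fun a => INR a <= D)%R) => [||v _]; [by apply: Rlt_le | by move=> *; apply: max_INR |].
  by apply/Rlt_le/clique_lt/blue_nbhd_red_clique.
(* As [W <= X <= s <= s * A], every distance [h < W] between windows lies in the range of [Hint]. *)
have W_le_m : W <= m by apply/leP/INR_le; rewrite mE; nra.
have kK : (INR k <= K)%R.
  apply: (big_ind (fun a => INR a <= K)%R) => [||h h_gt0]; [by apply/Rlt_le/pow0 | by move=> *; apply: max_INR |].
  by apply: Hint; rewrite h_gt0 (leq_trans (ltnW (ltn_ord h))).
have W_gt0 : 0 < W by apply/ltP/INR_lt => /=; lra.
have m_gt0 : 0 < m by apply: leq_trans W_le_m.
have mWE : INR (m + W).-1 = (s * A + INR W - 1)%R.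
  rewrite -mE -plus_INR plusE -{2}(prednK (_ : 0 < m + W)) ?addn_gt0 ?m_gt0 // S_INR; lra.
have mW : (m + W).-1 <= n by apply/leP/INR_le; rewrite mWE -ss.
have m_le_n : m <= n by move: mW W_gt0; lia.
have : W * (n - m) <= (m + W).-1 * d + 'C(W, 2) * (k * d).
  apply: (colouring_count Hn m_gt0 mW no_copy) => [v | h /andP[h_gt0 hW]].
    exact: (leq_bigmax_cond v).
  exact: (@leq_bigmax_cond _ _ (fun h : 'I_W => Int _ (shift_seq _ (Posz h))) (Ordinal hW)).
move/INR_leq; apply: Rlt_not_le.
rewrite -plusE plus_INR -!multE !mult_INR -minusE minus_INR; last exact/leP.
rewrite mWE INR_bin2 mE -ss.
apply: (@Rle_lt_trans _ ((s * A + INR W - 1) * INR d + INR W * (INR W - 1) / 2 * (K * INR d))).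
  apply: Rplus_le_compat_l; apply: Rmult_le_compat_l; first by nra.
  by apply: Rmult_le_compat_r => //; apply: pos_INR.
apply: (@window_count_too_small s A B X) => //; rewrite -?DE.
  by split=> //; apply: pos_INR.
by apply/Rlt_le/pow0.
Qed.
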